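(* Let $q=p^e$ with $p$ an odd prime and $e\ge2$ even. Let $f\in\mathcal{RF}$ with $\varepsilon$ the sign of its Walsh transform. Let $\beta$ be a generator of $\mathbb{F}_q^*$, let $d_1,\dots,d_q$ be the elements of $\mathbb{F}_q$ with $d_q=0$, and let $G_2$ be the $(e+2)\times q$ matrix with first row $(1,\dots,1)$, second row $(f(d_1)+1,\dots,f(d_q)+1)$, and $(i+3)$-th row $(\mathrm{Tr}_{q/p}(\beta^id_1),\dots,\mathrm{Tr}_{q/p}(\beta^id_q))$ for $0\le i\le e-1$. Let $\mathcal{C}_f'$ be the $p$-ary code generated by $G_2'=[I_{e+2}:G_2]$. If $\varepsilon(\eta_0(-1))^{e/2}=1$, then $\mathcal{C}_f'$ has parameters $[p^e+e+2,\ e+2,\ p^e-p^{e-1}-(p-1)p^{\frac e2-1}+2]$; if $\varepsilon(\eta_0(-1))^{e/2}=-1$, then $\mathcal{C}_f'$ has parameters $[p^e+e+2,\ e+2,\ p^e-p^{e-1}-p^{\frac e2-1}+1]$. Moreover, $\mathcal{C}_f'^{\perp}$ has parameters $[p^e+e+2,\ p^e,\ 3]$ and is at least almost optimal according to the sphere-packing bound.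
   Context: $\zeta_p=e^{2\pi i/p}$; $\mathrm{Tr}_{q/p}$ is the trace map from $\mathbb{F}_q$ to $\mathbb{F}_p$; $\eta_0$ is the quadratic character of $\mathbb{F}_p$; $p^*=(-1)^{(p-1)/2}p$ with $\sqrt{p^*}=\sqrt p$ if $p\equiv1\pmod 4$ and $\sqrt{-1}\sqrt p$ otherwise. Walsh transform of $f:\mathbb{F}_{p^e}\to\mathbb{F}_p$: $W_f(\beta)=\sum_x\zeta_p^{f(x)-\mathrm{Tr}_{p^e/p}(\beta x)}$; $f$ is weakly regular bent with sign $\varepsilon\in\{\pm1\}$ and dual $f^*:\mathbb{F}_{p^e}\to\mathbb{F}_p$ if $W_f(\beta)=\varepsilon\sqrt{p^*}^e\zeta_p^{f^*(\beta)}$ for all $\beta$. $\mathcal{RF}$ is the set of weakly regular bent $f$ with $f(0)=0$ and $f(ax)=a^hf(x)$ for all $a\in\mathbb{F}_p^*$, $x$, for some positive even $h$ with $\gcd(h-1,p-1)=1$. $G_2$ generates $\{(af(x)+\mathrm{Tr}_{q/p}(bx)+c)_{x\in\mathbb{F}_q}:a,c\in\mathbb{F}_p,b\in\mathbb{F}_q\}$. ''At least almost optimal according to the sphere-packing bound'' means the sphere-packing bound rules out a code with the same length and dimension and minimum distance $d+2$ (so the code is optimal or almost optimal). *)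

(* Defs.v *)
From HB Require Import structures.
From mathcomp Require Import all_boot all_order all_algebra all_field.
Set Implicit Arguments. Unset Strict Implicit. Unset Printing Implicit Defensive.
Import Order.TTheory GRing.Theory Num.Theory.
Local Open Scope ring_scope.

Definition Fp_to (p : nat) (F : finFieldType) (a : 'F_p) : F := (val a)%:R.

(* Absolute trace Tr_{q/p} : F_q -> F_p, q = p^e:
   Tr(x) = x + x^p + ... + x^(p^(e-1)), which lies in the prime field;
   we return the element of 'F_p whose image in F is this value. *)
Definition trace (p e : nat) (F : finFieldType) (x : F) : 'F_p :=
  odflt 0 [pick k : 'F_p | Fp_to F k == \sum_(i < e) x ^+ (p ^ i)].

Definition eta0 (p : nat) (a : 'F_p) : int :=
  if a == 0 then 0 else if [exists y : 'F_p, y ^+ 2 == a] then 1 else -1.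

Definition zeta (p : nat) : algC :=
  let: exist z _ := C_prim_root_exists (ltn0Sn p.-1) in z.

Definition sqrt_pstar (p : nat) : algC :=
  if (p %% 4 == 1)%N then sqrtC p%:R else 'i * sqrtC p%:R.

Definition walsh (p e : nat) (F : finFieldType) (f : F -> 'F_p) (b : F) : algC :=
  \sum_(x : F) zeta p ^+ (val (f x - trace p e (b * x))).

Definition wrb_sign (p e : nat) (F : finFieldType) (f : F -> 'F_p) (eps : int) : Prop :=
  (eps = 1 \/ eps = -1) /\
  exists fstar : F -> 'F_p, forall b : F,
    walsh e f b = eps%:~R * sqrt_pstar p ^+ e * zeta p ^+ (val (fstar b)).

Definition in_RF (p e : nat) (F : finFieldType) (f : F -> 'F_p) : Prop :=
  (exists eps, wrb_sign e f eps) /\ f 0 = 0 /\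
  exists h : nat, [/\ (0 < h)%N, ~~ odd h, coprime h.-1 p.-1 &
    forall (a : 'F_p) (x : F), a != 0 -> f (Fp_to F a * x) = a ^+ h * f x].

Definition wt (K : fieldType) (n : nat) (v : 'rV[K]_n) : nat :=
  #|[set i : 'I_n | v 0 i != 0]|.

Definition min_dist (K : fieldType) (k n : nat) (M : 'M[K]_(k, n)) (d : nat) : Prop :=
  (exists v : 'rV[K]_n, (v <= M)%MS /\ v != 0 /\ wt v = d) /\
  (forall v : 'rV[K]_n, (v <= M)%MS -> v != 0 -> (d <= wt v)%N).

Definition code_params (K : fieldType) (k n : nat) (M : 'M[K]_(k, n))
  (n0 k0 d0 : nat) : Prop :=
  n0 = n /\ \rank M = k0 /\ min_dist M d0.

Definition dual_gen (K : fieldType) (k n : nat) (M : 'M[K]_(k, n)) : 'M[K]_n :=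
  kermx M^T.

Definition sphere_packing_rules_out (q n k d : nat) : Prop :=
  (q ^ n < q ^ k * \sum_(i < ((d.-1)./2).+1) 'C(n, i) * (q.-1) ^ i)%N.

Definition G2 (p e : nat) (F : finFieldType) (f : F -> 'F_p) (beta : F)
  (d : 'I_(p ^ e) -> F) : 'M['F_p]_(e.+2, p ^ e) :=
  \matrix_(i < e.+2, j < p ^ e)
     if (i == 0 :> nat) then 1
     else if (i == 1 :> nat) then f (d j) + 1
     else trace p e (beta ^+ (i - 2) * d j).

Definition G2' (p e : nat) (F : finFieldType) (f : F -> 'F_p) (beta : F)
  (d : 'I_(p ^ e) -> F) : 'M['F_p]_(e.+2, e.+2 + p ^ e) :=
  row_mx 1%:M (G2 f beta d).

(* Main.v *)
(** Put s = eps * eta0(-1)^(e/2).  Since e is even, the Walsh transform reads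
    W_f(b) = s p^(e/2) zeta^(f*(b)), and as the only rational relations among
    the powers of zeta are the multiples of their sum, the fibres of
    x |-> f(x) - Tr(bx) have p^(e-1) - s p^(e/2-1) elements, plus s p^(e/2) for
    the fibre over f*(b).  This gives the weights of the code words with a
    nonzero coefficient at f.  Because f is even and f(0) = 0, all fibres of f
    over nonzero values have even size, and parity forces f*(0) = 0; this
    decides how many nonzero coordinates the identity block adds to the words
    of extremal weight.  In the dual, no column of [I : G2] is zero and no two
    are proportional, while the column at x = 0 is the sum of the first two
    unit vectors. *)
Require Import Defs.
From HB Require Import structures.
From mathcomp Require Import all_boot all_order all_algebra all_field.
From mathcomp Require Import zify ring.
Set Implicit Arguments. Unset Strict Implicit. Unset Printing Implicit Defensive.
Import Order.TTheory GRing.Theory Num.Theory.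
Local Open Scope ring_scope.

(** * The prime subfield and the trace *)

Section PrimeSubfield.

Variables (p : nat) (F : finFieldType).
Hypothesis charFp : p \in [pchar F].

Let p_pr : prime p. Proof. exact: pcharf_prime charFp. Qed.

Lemma Fp_to_inZp n : Fp_to F (inZp n : 'F_p) = n%:R.
Proof.
rewrite /Fp_to [in RHS](divn_eq n p) natrD mulrnA (mulrn_pchar charFp) add0r.
by rewrite /= (Fp_cast p_pr).
Qed.

Lemma Fp_to_is_zmod_morphism : zmod_morphism (@Fp_to p F).
Proof.
move=> a b; apply/eqP; rewrite eq_sym subr_eq; apply/eqP.
have D (u v : 'F_p) : Fp_to F (u + v) = Fp_to F u + Fp_to F v.
  by rewrite /Fp_to -natrD; exact: Fp_to_inZp.
by rewrite -D subrK.
Qed.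

Lemma Fp_to_is_monoid_morphism : monoid_morphism (@Fp_to p F).
Proof.
split=> [|a b]; first by rewrite /Fp_to /= mulr1n.
by rewrite /Fp_to -natrM; exact: Fp_to_inZp.
Qed.

HB.instance Definition _ :=
  GRing.isZmodMorphism.Build 'F_p F (@Fp_to p F) Fp_to_is_zmod_morphism.
HB.instance Definition _ :=
  GRing.isMonoidMorphism.Build 'F_p F (@Fp_to p F) Fp_to_is_monoid_morphism.

Lemma Fp_to_inj : injective (@Fp_to p F).
Proof. exact: fmorph_inj. Qed.

(** The image of ['F_p] already supplies the p roots that ['X^p - 'X] can have in a field, so a
    Frobenius-fixed element outside it would be one root too many. *)
Lemma Fp_to_frob_fix (y : F) : y ^+ p = y -> exists a : 'F_p, Fp_to F a = y.
Proof.
move=> yp; case: (boolP (y \in codom (@Fp_to p F))) => [/codomP[a ->]|ny].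
  by exists a.
have szq : size ('X^p - 'X : {poly F}) = p.+1.
  by rewrite size_polyDl size_polyXn // size_polyN size_polyX ltnS prime_gt1.
have := @max_poly_roots _ ('X^p - 'X) (y :: codom (@Fp_to p F)).
rewrite szq /= size_codom card_Fp // ltnn => H; exfalso.
suff: false by [].
apply: H; first by rewrite -size_poly_eq0 szq.
  rewrite rootE !hornerE yp subrr eqxx; apply/allP => _ /codomP[a ->].
  rewrite rootE !hornerE -rmorphXn /=.
  by have := expf_card a; rewrite card_Fp // => ->; rewrite subrr.
by rewrite ny /=; apply/injectiveP; exact: Fp_to_inj.
Qed.


Section Trace.

Variable e : nat.
Hypothesis cardF : #|F| = (p ^ e)%N.
Local Notation tr := (@trace p e F).

Let e_gt0 : (0 < e)%N.
Proof. by have := finNzRing_gt1 F; rewrite cardF; case: (e) => //; rewrite expn0. Qed.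

(** Frobenius permutes the terms cyclically because x^(p^e) = x, so their sum lies in the prime
    field; the [pick] in [trace] succeeds and its default 0 never intervenes. *)
Lemma Fp_to_trace x : Fp_to F (tr x) = \sum_(i < e) x ^+ (p ^ i).
Proof.
rewrite /trace; case: pickP => [k /eqP //|no].
have [|a aE] := @Fp_to_frob_fix (\sum_(i < e) x ^+ (p ^ i)); last first.
  by have := no a; rewrite aE eqxx.
have -> : (\sum_(i < e) x ^+ (p ^ i)) ^+ p = \sum_(i < e) x ^+ (p ^ i.+1).
  rewrite -(pFrobenius_autE charFp) rmorph_sum; apply: eq_bigr => i _.
  by rewrite /= pFrobenius_autE -exprM expnSr.
case: (e) e_gt0 cardF => // n _ oF; rewrite big_ord_recr big_ord_recl /= addrC.
by rewrite -oF expf_card expn0 expr1.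
Qed.

Lemma trace_is_linear (a : 'F_p) x y :
  tr (Fp_to F a * x + y) = a * tr x + tr y.
Proof.
apply: Fp_to_inj; rewrite rmorphD rmorphM /= !Fp_to_trace mulr_sumr -big_split /=.
apply: eq_bigr => i _.
have ap : Fp_to F a ^+ (p ^ i) = Fp_to F a.
  elim: (nat_of_ord i) => [|n IHn]; first by rewrite expn0 expr1.
  rewrite expnSr exprM IHn -rmorphXn /=; congr (Fp_to F _).
  by have := expf_card a; rewrite card_Fp.
by rewrite exprDn_pchar ?pnatX ?pnatE ?charFp // exprMn ap.
Qed.

Lemma traceD x y : tr (x + y) = tr x + tr y.
Proof. by have := trace_is_linear 1 x y; rewrite rmorph1 !mul1r. Qed.

Lemma trace0 : tr 0 = 0.
Proof. by apply: (addrI (tr 0)); rewrite -traceD !addr0. Qed.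

Lemma traceN x : tr (- x) = - tr x.
Proof. by apply: (addrI (tr x)); rewrite -traceD !subrr trace0. Qed.

Lemma traceZ (a : 'F_p) x : tr (Fp_to F a * x) = a * tr x.
Proof. by have := trace_is_linear a x 0; rewrite trace0 !addr0. Qed.

Lemma trace_sum (I : finType) (G : I -> F) : tr (\sum_i G i) = \sum_i tr (G i).
Proof. by apply: (big_morph _ traceD trace0). Qed.

(** Otherwise all p^e elements of [F] would be roots of a nonzero polynomial of degree at most
    p^(e-1). *)
Lemma trace_neq0 : exists x, tr x != 0.
Proof.
apply/existsP; rewrite -negb_forall; apply/negP => /forallP tr0.
pose P : {poly F} := \sum_(i < e) 'X^(p ^ i).
have szP : (size P <= (p ^ e.-1).+1)%N.
  apply/(leq_trans (size_sum _ _ _))/bigmax_leqP => i _.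
  rewrite size_polyXn ltnS leq_exp2l ?prime_gt1 //.
  by rewrite -ltnS prednK.
have Pneq0 : P != 0.
  (* The coefficient of X is 1, since only the term i = 0 has degree 1. *)
  apply/eqP => /(congr1 (fun Q : {poly F} => Q`_1)); rewrite coef0 coef_sum.
  case: (e) e_gt0 => // n _; rewrite big_ord_recl big1 => [|i _].
    by rewrite /= expn0 coefXn addr0 => /eqP; rewrite oner_eq0.
  have : (1 < p ^ bump 0 i)%N by rewrite -{1}(expn0 p) ltn_exp2l ?prime_gt1.
  by rewrite coefXn ltn_neqAle => /andP[/negPf->].
have := max_poly_roots Pneq0 _ (enum_uniq F).
rewrite -cardE cardF ltnNge (leq_trans szP) => [H|]; last first.
  by rewrite ltn_exp2l ?prime_gt1 // prednK.
suff: false by [].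
apply: H; apply/allP => x _; rewrite rootE horner_sum.
under eq_bigr do rewrite hornerXn.
by rewrite -Fp_to_trace (eqP (tr0 x)) rmorph0.
Qed.

(** By linearity each fibre is a translate of the one over 0, by a [y] with tr(b y) = v; so the p
    fibres share the p^e elements equally. *)
Lemma card_trace_fiber (b : F) (c : 'F_p) :
  b != 0 -> #|[set x | tr (b * x) == c]| = (p ^ e.-1)%N.
Proof.
move=> b0; have [x0 x0P] := trace_neq0.
pose A v := [set x | tr (b * x) == v].
have AE v : #|A v| = #|A 0|.
  pose y := b^-1 * (Fp_to F (v / tr x0) * x0).
  have yE : tr (b * y) = v by rewrite mulVKf // traceZ divfK.
  rewrite -(card_imset (mem (A 0)) (addrI y)); apply: eq_card => x.
  apply/idP/imsetP => [|[z zP ->]]; rewrite !inE; last first.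
    by move: zP; rewrite inE => /eqP zP; rewrite mulrDr traceD yE zP addr0.
  move=> /eqP xv; exists (x - y); last by rewrite addrC subrK.
  by rewrite inE mulrBr traceD traceN yE xv subrr.
have : (\sum_v #|A v| = p ^ e)%N.
  rewrite -cardF -sum1_card (partition_big (fun x => tr (b * x)) xpredT) //=.
  by apply: eq_bigr => v _; rewrite -sum1_card; apply: eq_bigl => x; rewrite inE.
under eq_bigr do rewrite AE.
rewrite sum_nat_const card_Fp // -[in RHS](prednK e_gt0) expnS => /eqP.
by rewrite eqn_pmul2l ?prime_gt0 // -(AE c) => /eqP.
Qed.

Lemma trace_nondegenerate (x : F) : (forall b, tr (b * x) = 0) -> x = 0.
Proof.
move=> H; apply/eqP; apply: contraT => x0; have [y] := trace_neq0.
by rewrite -(divfK x0 y) H eqxx.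
Qed.

(** * Powers of a primitive element as a basis over the prime field *)

Section PowerBasis.

Variable beta : F.
Hypothesis beta_prim : (#|F|.-1).-primitive_root beta.

Lemma primitive_powers (x : F) : x != 0 -> exists k, x = beta ^+ k.
Proof.
move=> x0.
have F1 : (0 < #|F|.-1)%N by rewrite -ltnS prednK ?finNzRing_gt1 // ltnW ?finNzRing_gt1.
have xu : x ^+ #|F|.-1 = 1.
  by apply: (mulfI x0); rewrite -exprS prednK ?expf_card ?mulr1 // ltnW ?finNzRing_gt1.
by have [k ->] := prim_rootP beta_prim xu; exists k.
Qed.

(** Suppose a nonzero polynomial [A] of degree m < e kills [beta]. Reducing X^k modulo [A] writes
    every power of [beta], hence every element of [F], with m coefficients, and [F] would have at
    most p^m elements. *)
Lemma powers_free (u : 'rV['F_p]_e) :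
  \sum_(i < e) Fp_to F (u 0 i) * beta ^+ i = 0 -> u = 0.
Proof.
move=> u0; apply: contra_eq u0 => unz.
pose phi := map_poly (@Fp_to p F).
pose A := rVpoly u.
have Anz : A != 0 by rewrite /A raddf_eq0 //; exact: (can_inj (rVpolyK (d := e))).
have AE : (phi A).[beta] = \sum_(i < e) Fp_to F (u 0 i) * beta ^+ i.
  rewrite /phi /A (horner_coef_wide _ (n := e)) ?size_map_poly ?size_poly //.
  by apply: eq_bigr => i _; rewrite coef_map coef_rVpoly_ord.
rewrite -AE; apply/negP => /eqP Ab.
pose m := (size A).-1.
pose g (v : 'rV['F_p]_m) := (phi (rVpoly v)).[beta].
have g_surj (x : F) : exists v, g v = x.
  have [->|/primitive_powers[k ->]] := eqVneq x 0.
    by exists 0; rewrite /g raddf0 /phi rmorph0 horner0.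
  exists (poly_rV ('X^k %% A)); rewrite /g poly_rV_K; last first.
    by rewrite /m -ltnS prednK ?ltn_modp // lt0n size_poly_eq0.
  have := congr1 (fun Q => (phi Q).[beta]) (divp_eq 'X^k A).
  rewrite /phi /= rmorphD rmorphM hornerD hornerM -/phi Ab mulr0 add0r => <-.
  by rewrite /phi map_polyXn hornerXn.
have : (#|F| <= #|{: 'rV['F_p]_m}|)%N.
  have sE : codom g =i F by move=> x; apply/codomP; have [v <-] := g_surj x; exists v.
  by rewrite -(eq_card sE) /codom; exact: leq_image_card.
rewrite card_mx card_Fp // mul1n cardF leq_exp2l ?prime_gt1 //.
have : (size A <= e)%N by exact: size_poly.
have : (0 < size A)%N by rewrite lt0n size_poly_eq0.
rewrite /m; lia.
Qed.

Lemma powers_span (b : F) :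
  exists u : 'rV['F_p]_e, \sum_(i < e) Fp_to F (u 0 i) * beta ^+ i = b.
Proof.
pose g (u : 'rV['F_p]_e) := \sum_(i < e) Fp_to F (u 0 i) * beta ^+ i.
have g_inj : injective g.
  move=> u v uv; apply/eqP; rewrite -subr_eq0; apply/eqP/powers_free.
  under eq_bigr do rewrite !mxE rmorphB mulrBl.
  by rewrite sumrB -/(g u) -/(g v) uv subrr.
have /codomP[u ->] : b \in codom g; last by exists u.
by apply: inj_card_onto => //; rewrite cardF card_mx card_Fp // mul1n.
Qed.

End PowerBasis.
End Trace.
End PrimeSubfield.

(** * Fibres of weakly regular bent functions *)

Lemma zeta_prim (p : nat) : prime p -> p.-primitive_root (zeta p).
Proof.
move=> p_pr; rewrite /zeta; case: C_prim_root_exists => z.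
by rewrite prednK ?prime_gt0.
Qed.

(* The minimal polynomial of zeta has degree p - 1, so the only rational
   relations between the p powers of zeta are the multiples of their sum. *)
Lemma zeta_relation (p : nat) (c : 'F_p -> rat) : prime p ->
  \sum_v ratr (c v) * zeta p ^+ (val v) = 0 -> forall u v, c u = c v.
Proof.
move=> p_pr.
have zP := zeta_prim p_pr.
have [m [mE m_mon] mP] := minCpolyP (zeta p).
have szm : size m = p.
  rewrite -(size_map_poly (ratr : {rmorphism rat -> algC})) -mE.
  rewrite (minCpoly_cyclotomic zP) size_cyclotomic totient_prime //.
  by rewrite prednK ?prime_gt0.
(* The coefficients of a relation form a polynomial of degree less than p that is divisible by [m],
   of degree p - 1, hence a scalar multiple of [m]. *)
have scale_of_root (b : 'F_p -> rat) :
    \sum_v ratr (b v) * zeta p ^+ (val v) = 0 ->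
    exists k, forall v, b v = k * m`_(val v).
  move=> b0; pose P : {poly rat} := \sum_v b v *: 'X^(val v).
  have PE (v : 'F_p) : P`_(val v) = b v.
    rewrite /P coef_sum (bigD1 v) //= coefZ coefXn eqxx mulr1 big1 ?addr0 // => u.
    by rewrite coefZ coefXn eq_sym -(inj_eq val_inj) /= => /negPf->; rewrite mulr0.
  have szP : (size P <= p)%N.
    apply/(leq_trans (size_sum _ _ _))/bigmax_leqP => v _.
    rewrite (leq_trans (size_scale_leq _ _)) // size_polyXn.
    by rewrite -[leqRHS](Fp_cast p_pr) ltn_ord.
  have : m %| P.
    rewrite -mP rootE /P rmorph_sum horner_sum -[X in _ == X]b0; apply/eqP.
    by apply: eq_bigr => v _; rewrite /= map_polyZ map_polyXn hornerZ hornerXn.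
  case: (eqVneq P 0) => [P0 _|Pnz mdvd].
    by exists 0 => v; rewrite -PE P0 coef0 mul0r.
  have : m %= P.
    rewrite -(dvdp_size_eqp mdvd) eqn_leq (dvdp_leq Pnz mdvd) /=.
    by rewrite szm.
  move/eqpP => [[k1 k2] /= /andP[k1nz k2nz] E].
  exists (k1 / k2) => v; rewrite -PE -[P]scale1r -(mulVf k2nz) -scalerA -E.
  by rewrite scalerA coefZ [k2^-1 * _]mulrC.
case/scale_of_root => k kE.
(* The vanishing sum of all powers is itself a relation, which forces the coefficients of [m] to be
   equal. *)
have [|k1 k1E] := scale_of_root (fun=> 1).
  have geo0 : \sum_(i < p) zeta p ^+ i = 0.
    have := subrX1 (zeta p) p; rewrite (prim_expr_order zP) subrr.
    move/esym/eqP; rewrite mulf_eq0 subr_eq0 => /orP[/eqP z1|/eqP //].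
    have : (p %| 1)%N by rewrite (prim_order_dvd zP) expr1 z1.
    by rewrite dvdn1 => /eqP p1; move: p_pr; rewrite p1.
  rewrite -[RHS]geo0 -(big_mkord xpredT (fun i => zeta p ^+ i)).
  rewrite -[X in index_iota 0 X](Fp_cast p_pr).
  by rewrite big_mkord; apply: eq_bigr => v _; rewrite rmorph1 mul1r.
have k1nz : k1 != 0.
  by apply/eqP => k10; have := k1E 0; rewrite k10 mul0r => /eqP; rewrite oner_eq0.
by move=> u v; rewrite !kE; congr (_ * _); apply: (mulfI k1nz); rewrite -!k1E.
Qed.

(** Moving the right-hand side into the coefficient at [j] gives a rational relation among the
    powers of zeta. The corrected fibre sizes [D] are therefore all equal, and their total p^(2m) -
    s p^m determines them. *)
Lemma card_fiber_bent (p m : nat) (T : finType) (g : T -> 'F_p) (s : int) (j : 'F_p) :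
  prime p -> (0 < m)%N -> #|T| = (p ^ m.*2)%N ->
  \sum_x zeta p ^+ (val (g x)) = s%:~R * p%:R ^+ m * zeta p ^+ (val j) ->
  forall v, (#|[set x | g x == v]|)%:Z =
    p%:Z ^+ m.*2.-1 - s * p%:Z ^+ m.-1 + (v == j)%:R * (s * p%:Z ^+ m).
Proof.
move=> p_pr m0 cT gE v.
pose N u : int := #|[set x | g x == u]|%:Z.
pose D u : int := N u - (u == j)%:R * (s * p%:Z ^+ m).
have DE u w : D u = D w.
  have := @zeta_relation p (fun u => (D u)%:~R) p_pr _ u w.
  move=> H; apply/eqP; rewrite -(eqr_int rat); apply/eqP/H.
  under eq_bigr do rewrite ratr_int /D rmorphB /= mulrBl.
  rewrite sumrB; apply/eqP; rewrite subr_eq0; apply/eqP.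
  rewrite [RHS](bigD1 j) //= eqxx mul1r [X in _ = _ + X]big1 ?addr0; last first.
    by move=> i /negPf->; rewrite mul0r rmorph0 mul0r.
  rewrite rmorphM rmorphXn /= -[X in _ = _ * X ^+ _ * _]/(p%:R) -gE.
  rewrite [RHS](partition_big g xpredT) //=; apply: eq_bigr => i _.
  rewrite (eq_bigr (fun=> zeta p ^+ val i)); last by move=> x /eqP->.
  rewrite sumr_const mulr_natl; congr (_ *+ _).
  by apply: eq_card => x; rewrite !inE.
have sumD : p%:Z * D v = p%:Z ^+ m.*2 - s * p%:Z ^+ m.
  have -> : p%:Z * D v = \sum_u D u.
    by rewrite (eq_bigr (fun=> D v)) // sumr_const card_Fp // -[p%:Z]natz mulr_natl.
  rewrite sumrB; congr (_ - _); last first.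
    rewrite (bigD1 j) //= eqxx mul1r big1 ?addr0 // => i /negPf->.
    by rewrite mul0r.
  rewrite /N -!natz -natrX natz -cT -sum1_card (partition_big g xpredT) //=.
  under eq_bigr do rewrite -natz.
  rewrite -natr_sum natz; congr Posz; apply: eq_bigr => u _.
  by rewrite -sum1_card; apply: eq_bigl => x; rewrite inE.
have pnz : p%:Z != 0 by have := prime_gt0 p_pr; lia.
have : D v = p%:Z ^+ m.*2.-1 - s * p%:Z ^+ m.-1.
  apply: (mulfI pnz); rewrite sumD mulrBr mulrCA -!exprS !prednK //.
  by rewrite double_gt0.
by move=> <-; rewrite /D subrK.
Qed.

(** Let h = (p-1)/2. A square root y of -1 gives (-1)^h = y^(p-1) = 1, so h is even. Conversely, for
    even h, any y with y^h = -1 yields the square root y^(h/2). *)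
Lemma eta0_opp1 (p : nat) : prime p -> odd p ->
  eta0 (-1 : 'F_p) = if (p %% 4 == 1)%N then 1 else -1.
Proof.
move=> p_pr p_odd.
have p2 : (2 < p)%N by have := prime_gt1 p_pr; lia.
pose h := p./2; have pE : p = h.*2.+1 by rewrite /h; lia.
have Fh (y : 'F_p) : y != 0 -> y ^+ h.*2 = 1.
  move=> y0; apply: (mulfI y0); rewrite -exprS -pE mulr1.
  by have := expf_card y; rewrite card_Fp.
have opp1 : (-1 : 'F_p) != 1.
  rewrite eq_sym -subr_eq0 opprK -(natrD _ 1 1) -(dvdn_pcharf (pchar_Fp p_pr)).
  by rewrite gtnNdvd.
rewrite /eta0 oppr_eq0 oner_eq0.
case: existsP => [[y /eqP y2]|nex].
  have y0 : y != 0.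
    by apply: contra_eq_neq y2 => ->; rewrite expr0n /= eq_sym oppr_eq0 oner_eq0.
  have := Fh y y0; rewrite -mul2n exprM y2 -signr_odd.
  case: (boolP (odd h)) => [_ /eqP|hev _]; first by rewrite expr1 (negPf opp1).
  by have -> : (p %% 4 == 1)%N by lia.
case: ifP => // p4; exfalso; apply: nex.
have h_ev : h = (h./2).*2 by lia.
(* ['X^(h.+1) - 'X] has at most h + 1 < p roots; the extra factor X ensures that the non-root found
   is nonzero. *)
have /existsP[y yh] : [exists y : 'F_p, y ^+ h.+1 != y].
  rewrite -negb_forall; apply/negP => /forallP H.
  have szP : size ('X^(h.+1) - 'X : {poly 'F_p}) = h.+2.
    by rewrite size_polyDl size_polyXn // size_polyN size_polyX; lia.
  have := @max_poly_roots _ ('X^(h.+1) - 'X) (enum 'F_p).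
  rewrite szP -cardE card_Fp // => H'.
  suff : (p < h.+2)%N by lia.
  apply: H'; rewrite ?enum_uniq // -?size_poly_eq0 ?szP //.
  by apply/allP => y _; rewrite rootE !hornerE (eqP (H y)) subrr.
have y0 : y != 0 by apply: contraNneq yh => ->; rewrite expr0n.
exists (y ^+ h./2); rewrite -exprM muln2 -h_ev.
have : (y ^+ h) ^+ 2 == 1 by rewrite -exprM muln2 Fh.
rewrite sqrf_eq1 => /orP[/eqP yh1|//].
by move: yh; rewrite exprS yh1 mulr1 eqxx.
Qed.

Lemma sqrt_pstarX (p m : nat) : prime p -> odd p ->
  sqrt_pstar p ^+ m.*2 = (eta0 (-1 : 'F_p) ^+ m)%:~R * p%:R ^+ m.
Proof.
move=> p_pr p_odd; rewrite eta0_opp1 // -mul2n exprM rmorphXn /= -exprMn.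
congr (_ ^+ m); rewrite /sqrt_pstar; case: ifP => _.
  by rewrite sqrtCK mul1r.
by rewrite exprMn sqrCi sqrtCK.
Qed.

(** As 2 is invertible, x and -x differ for x in [A]. [B] keeps the member of each pair that comes
    first in the enumeration of [F], so [A] is the disjoint union of [B] and -[B]. *)
Lemma even_card_opp_closed (F : finFieldType) (A : {set F}) :
  (2%:R : F) != 0 -> 0 \notin A -> (forall x, x \in A -> - x \in A) -> ~~ odd #|A|.
Proof.
move=> F2 A0 AN.
pose r (x : F) := nat_of_ord (enum_rank x).
pose B := [set x in A | (r x < r (- x))%N].
have rN x : x \in A -> r x != r (- x).
  move=> xA; apply: contraNneq A0 => /val_inj/enum_rank_inj xN.
  suff x0 : x = 0 by rewrite -x0.
  by apply/eqP; rewrite -(mulrI_eq0 _ (mulfI F2)) mulr_natl mulr2n {1}xN addNr.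
have AE : A = B :|: [set - x | x in B].
  apply/setP => x; rewrite !inE; apply/idP/orP => [xA|].
    have := rN x xA; rewrite neq_ltn => /orP[lt|lt]; first by left; rewrite xA lt.
    right; apply/imsetP; exists (- x); last by rewrite opprK.
    by rewrite inE AN //= opprK lt.
  by case=> [/andP[]//|/imsetP[y]]; rewrite inE => /andP[yA _] ->; exact: AN.
have dis : B :&: [set - x | x in B] = set0.
  apply/setP => x; rewrite !inE; apply/negP => /andP[/andP[_ lt] /imsetP[y]].
  by rewrite inE => /andP[_ lt'] xE; move: lt; rewrite xE opprK ltnNge (ltnW lt').
by rewrite AE cardsU dis cards0 subn0 card_imset ?addnn ?odd_double //; exact: oppr_inj.
Qed.

(** * Weights *)

Lemma wt_row_mx (K : fieldType) (m n : nat) (a : 'rV[K]_m) (b : 'rV[K]_n) :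
  wt (row_mx a b) = (wt a + wt b)%N.
Proof.
rewrite /wt -!sum1dep_card big_split_ord /=.
by congr (_ + _)%N; apply: eq_bigl => i; rewrite ?row_mxEl ?row_mxEr.
Qed.

Lemma wt_gt0 (K : fieldType) (n : nat) (a : 'rV[K]_n) : (0 < wt a)%N = (a != 0).
Proof.
rewrite card_gt0; apply/set0Pn/rV0Pn => -[i]; rewrite ?inE => ai; exists i => //.
by rewrite inE.
Qed.

Lemma wt_ge2 (K : fieldType) (n : nat) (a : 'rV[K]_n) (i j : 'I_n) :
  i != j -> a 0 i != 0 -> a 0 j != 0 -> (2 <= wt a)%N.
Proof.
move=> ij ai aj; have <- : #|[set i; j]| = 2%N by rewrite cards2 ij.
by apply/subset_leq_card/subsetP => k; rewrite !inE => /orP[]/eqP->.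
Qed.

Lemma wt_le1 (K : fieldType) (n : nat) (a : 'rV[K]_n) (i : 'I_n) :
  a 0 i != 0 -> (wt a <= 1)%N -> forall j, j != i -> a 0 j = 0.
Proof.
move=> ai; rewrite leqNgt => wa j ji; apply: contraNeq wa => aj.
exact: wt_ge2 ji aj ai.
Qed.

Section BentCode.

Variables (p e : nat) (F : finFieldType) (f : F -> 'F_p) (beta : F).
Variable d : 'I_(p ^ e) -> F.
Hypothesis p_pr : prime p.
Hypothesis cardF : #|F| = (p ^ e)%N.
Hypothesis beta_prim : (#|F|.-1).-primitive_root beta.
Hypothesis d_bij : bijective d.
Hypothesis f0 : f 0 = 0.

Let charFp : p \in [pchar F]. Proof. exact: card_finPcharP cardF p_pr. Qed.

Let i0 : 'I_e.+2 := ord0.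
Let i1 : 'I_e.+2 := lift ord0 ord0.
Let it (i : 'I_e) : 'I_e.+2 := lift ord0 (lift ord0 i).

Let ordP (i : 'I_e.+2) : [\/ i = i0, i = i1 | exists k, i = it k].
Proof.
case: (unliftP ord0 i) => [j ->|->]; last by constructor 1.
case: (unliftP ord0 j) => [k ->|->]; last by constructor 2.
by constructor 3; exists k.
Qed.

Local Notation G := (G2 f beta d).
Local Notation G' := (G2' f beta d).
Local Notation tr := (@trace p e F).

Lemma G2_row0 j : G i0 j = 1. Proof. by rewrite mxE. Qed.
Lemma G2_row1 j : G i1 j = f (d j) + 1. Proof. by rewrite mxE. Qed.
Lemma G2_rowt k j : G (it k) j = tr (beta ^+ k * d j).
Proof. by rewrite mxE /= /bump /= !add1n subn2. Qed.

(** The element b for which the trace rows contribute x |-> Tr(bx) to [u *m G]. *)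
Definition coef_elt (u : 'rV['F_p]_e.+2) : F :=
  \sum_(k < e) Fp_to F (u 0 (it k)) * beta ^+ k.

Lemma coef_elt_eq0 u : coef_elt u = 0 -> forall k, u 0 (it k) = 0.
Proof.
move=> u0 k; have := @powers_free _ _ charFp _ cardF _ beta_prim (\row_k u 0 (it k)).
move=> /(_ _)/rowP/(_ k); rewrite !mxE; apply.
by rewrite -[RHS]u0; apply: eq_bigr => i _; rewrite mxE.
Qed.

Lemma mul_G2E (u : 'rV['F_p]_e.+2) j :
  (u *m G) 0 j = u 0 i0 + u 0 i1 * (f (d j) + 1) + tr (coef_elt u * d j).
Proof.
rewrite mxE !big_ord_recl G2_row0 G2_row1 mulr1 addrA; congr (_ + _).
rewrite mulr_suml (trace_sum charFp cardF); apply: eq_bigr => k _.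
by rewrite G2_rowt -mulrA (traceZ charFp cardF).
Qed.

Definition zeros (u : 'rV['F_p]_e.+2) : {set F} :=
  [set x | u 0 i0 + u 0 i1 * (f x + 1) + tr (coef_elt u * x) == 0].

Lemma wt_mul_G2 u : (wt (u *m G) + #|zeros u| = p ^ e)%N.
Proof.
rewrite -[RHS]cardF -(cardC (mem (zeros u))) addnC; congr (_ + _)%N.
rewrite /wt -(card_imset _ (bij_inj d_bij)); apply: eq_card => x.
case: d_bij => d' dK d'K; apply/imsetP/idP => [[j]|].
  by rewrite !inE mul_G2E => H ->.
by rewrite !inE => H; exists (d' x); rewrite ?d'K // inE mul_G2E d'K.
Qed.

Lemma rank_G2' : \rank G' = e.+2.
Proof.
apply/eqP; rewrite -[_ == _]/(row_free _); apply/row_freeP.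
by exists (col_mx 1%:M 0); rewrite mul_row_col mulmx0 addr0 mulmx1.
Qed.

Lemma codewordP (v : 'rV['F_p]_(e.+2 + p ^ e)) :
  reflect (exists u, v = row_mx u (u *m G)) (v <= G')%MS.
Proof.
apply: (iffP submxP) => -[u ->]; exists u; by rewrite mul_mx_row mulmx1.
Qed.

(** Codewords have the form (u, uG), and the identity block adds [wt u]; the distance thus balances
    the weight of [u] against the number of zeros of its function on [F]. *)
Lemma min_dist_G2' D :
  (exists2 u : 'rV['F_p]_e.+2, u != 0 & (wt u + (p ^ e - #|zeros u|) = D)%N) ->
  (forall u : 'rV['F_p]_e.+2, u != 0 -> (D <= wt u + (p ^ e - #|zeros u|))%N) ->
  min_dist G' D.
Proof.
have wtE u : wt (row_mx u (u *m G)) = (wt u + (p ^ e - #|zeros u|))%N.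
  by rewrite wt_row_mx; have := wt_mul_G2 u; lia.
case=> u u0 uD uP; split.
  exists (row_mx u (u *m G)); split; first by apply/codewordP; exists u.
  by rewrite wtE uD; split=> //; rewrite -wt_gt0 wtE; move: u0; rewrite -wt_gt0; lia.
move=> v /codewordP[w ->]; rewrite wtE => w0; apply: uP.
by apply: contraNneq w0 => ->; rewrite mul0mx row_mx0.
Qed.

(** Without [f] the function is affine: its zero set is a trace fibre if the linear part is nonzero,
    and empty otherwise, because [u != 0] then leaves a nonzero constant. *)
Lemma zeros_affine (u : 'rV['F_p]_e.+2) : u != 0 -> u 0 i1 = 0 -> (#|zeros u| <= p ^ e.-1)%N.
Proof.
move=> u0 u1; case: (eqVneq (coef_elt u) 0) => [b0|b0].
  suff -> : zeros u = set0 by rewrite cards0.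
  apply/setP => x; rewrite !inE u1 b0 !mul0r (trace0 charFp cardF) !addr0.
  apply: contraNF u0 => /eqP u00; apply/eqP/rowP => i; rewrite mxE.
  by case: (ordP i) => [->|->|[k ->]] //; exact: coef_elt_eq0.
rewrite -(card_trace_fiber charFp cardF (- u 0 i0) b0); apply: subset_leq_card.
apply/subsetP => x; rewrite !inE u1 mul0r addr0 => /eqP xE.
by rewrite -addr_eq0 addrC xE.
Qed.

(** Dividing by the coefficient of [f] brings the equation to the shape whose solutions the Walsh
    transform counts. *)
Lemma zeros_bent (u : 'rV['F_p]_e.+2) : u 0 i1 != 0 ->
  zeros u = [set x | f x - tr (Fp_to F (- (u 0 i1)^-1) * coef_elt u * x)
                       == - (u 0 i0 / u 0 i1) - 1].
Proof.
move=> u1; apply/setP => x; rewrite !inE -mulrA (traceZ charFp cardF).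
rewrite -[RHS]subr_eq0 -[RHS](mulrI_eq0 _ (mulfI u1)); congr (_ == 0); field.
exact: u1.
Qed.

(** * The minimum distance for either sign *)

Section Weights.

Variables (s : int) (fstar : F -> 'F_p).
Hypothesis e_gt0 : (0 < e)%N.
Hypothesis e_even : ~~ odd e.
Hypothesis card_fiber : forall b v, #|[set x | f x - tr (b * x) == v]|%:Z =
  p%:Z ^+ e.-1 - s * p%:Z ^+ (e./2).-1 + (v == fstar b)%:R * (s * p%:Z ^+ e./2).
Hypothesis fstar0 : fstar 0 = 0.

(** With [X] and [p * X] standing for p^(e/2-1) and p^(e/2), the inequalities below reduce every
    comparison of weights to linear arithmetic. *)
Let X := (p ^ (e./2).-1)%N.

Let X_gt0 : (0 < X)%N. Proof. by rewrite expn_gt0 prime_gt0. Qed.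

Let X_le : (X.*2 <= p * X)%N. Proof. by rewrite -mul2n leq_mul2r prime_gt1 ?orbT. Qed.

Let pX_le : (p * X <= p ^ e.-1)%N.
Proof. by rewrite /X -expnS leq_exp2l ?prime_gt1 //; lia. Qed.

Let pe_ge : (p ^ e.-1 + p * X <= p ^ e)%N.
Proof.
rewrite (leq_trans (leq_add (leqnn _) pX_le)) // -[in leqRHS](prednK e_gt0) expnS.
by rewrite addnn -mul2n leq_mul2r prime_gt1 ?orbT.
Qed.

Let card_zeros (u : 'rV['F_p]_e.+2) : u 0 i1 != 0 ->
  #|zeros u|%:Z = (p ^ e.-1)%N%:Z - s * X%:Z +
   (- (u 0 i0 / u 0 i1) - 1 == fstar (Fp_to F (- (u 0 i1)^-1) * coef_elt u))%:R
      * (s * (p * X)%N%:Z).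
Proof.
move=> u1; rewrite (zeros_bent u1) card_fiber.
have XE n : p%:Z ^+ n = (p ^ n)%N%:Z by rewrite -[p%:Z]natz -natrX natz.
by rewrite !XE /X -expnS prednK //; lia.
Qed.

Let basis_word (a c : 'F_p) : 'rV['F_p]_e.+2 :=
  \row_i (if i == i0 then c else if i == i1 then a else 0).

Let coef_basis_word a c : coef_elt (basis_word a c) = 0.
Proof.
apply: big1 => k _; rewrite mxE /=.
by rewrite /Fp_to mulr0n mul0r.
Qed.

Let basis_word_neq0 c : basis_word 1 c != 0.
Proof. by apply/rV0Pn; exists i1; rewrite mxE oner_neq0. Qed.

Let wt_basis_word a c : wt (basis_word a c) = ((c != 0%R) + (a != 0%R))%N.
Proof.
rewrite /wt -sum1dep_card big_mkcond !big_ord_recl big1 ?addn0 => [|k _].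
  by rewrite !mxE /=; do 2!case: eqP.
by rewrite mxE /=.
Qed.

(* A single nonzero coordinate in position 1 gives the function a (f + 1),
   which is not extremal because [fstar 0 = 0]. *)
Let wt_extremal (u : 'rV['F_p]_e.+2) : u 0 i1 != 0 ->
  - (u 0 i0 / u 0 i1) - 1 = fstar (Fp_to F (- (u 0 i1)^-1) * coef_elt u) ->
  (2 <= wt u)%N.
Proof.
move=> u1 uE; rewrite ltnNge; apply/negP => /(wt_le1 u1) uz.
move: uE; rewrite (uz i0) // mul0r oppr0 sub0r.
have -> : coef_elt u = 0.
  by apply: big1 => k _; rewrite uz // /Fp_to mulr0n mul0r.
by rewrite mulr0 fstar0 => /eqP; rewrite oppr_eq0 oner_eq0.
Qed.

(** For s = 1 the fibre over a dual value is the large one, with p^(e-1) + (p-1)X elements, and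
    [wt_extremal] makes such words pay at least 2 in the identity block. *)
Lemma min_dist_pos : s = 1 ->
  min_dist G' (p ^ e - p ^ e.-1 - p.-1 * p ^ (e./2).-1 + 2)%N.
Proof.
move=> s1; rewrite -(subn1 p) mulnBl mul1n -/X.
apply: min_dist_G2'.
  (* Row 1 minus row 0 is [f] itself, whose zero set is the large fibre because [fstar 0 = 0]. *)
  exists (basis_word 1 (-1)); first exact: basis_word_neq0.
  have u1 : basis_word 1 (-1) 0 i1 != 0 by rewrite mxE oner_neq0.
  have := card_zeros u1; rewrite coef_basis_word mulr0 fstar0 !mxE /=.
  rewrite divr1 opprK subrr eqxx mul1r s1 !mul1r wt_basis_word oppr_eq0 oner_neq0.
  by clear -X_le pX_le pe_ge; lia.
move=> u u0; have := u0; rewrite -wt_gt0; have [u1|u1] := eqVneq (u 0 i1) 0.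
  by have := zeros_affine u0 u1; clear -X_gt0 X_le pX_le pe_ge; lia.
have := card_zeros u1; case: eqP => [/(wt_extremal u1)|_].
  by rewrite s1 !mul1r; clear -X_le pX_le pe_ge; lia.
by rewrite s1 !mul1r mul0r addr0; clear -X_gt0 X_le pX_le pe_ge; lia.
Qed.

(** For s = -1 the fibres off the dual value are the large ones, with p^(e-1) + X elements, and one
    nonzero coefficient suffices to reach them. *)
Lemma min_dist_neg : s = -1 ->
  min_dist G' (p ^ e - p ^ e.-1 - p ^ (e./2).-1 + 1)%N.
Proof.
move=> s1; rewrite -/X.
apply: min_dist_G2'.
  (* Row 1 is f + 1; its zeros form the fibre of [f] over -1, which differs from [fstar 0 = 0]. *)
  exists (basis_word 1 0); first exact: basis_word_neq0.
  have u1 : basis_word 1 0 0 i1 != 0 by rewrite mxE oner_neq0.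
  have := card_zeros u1; rewrite coef_basis_word mulr0 fstar0 !mxE /=.
  rewrite mul0r oppr0 sub0r oppr_eq0 oner_eq0 mul0r s1 mulN1r wt_basis_word eqxx.
  by rewrite oner_neq0; clear -X_le pX_le pe_ge; lia.
move=> u u0; have := u0; rewrite -wt_gt0; have [u1|u1] := eqVneq (u 0 i1) 0.
  by have := zeros_affine u0 u1; clear -X_le pX_le pe_ge; lia.
have := card_zeros u1; rewrite s1 !mulN1r.
by case: eqP => _; rewrite ?mul1r ?mul0r; clear -X_le pX_le pe_ge; lia.
Qed.

End Weights.

(** * The dual code *)

Lemma dual_G2'P (a : 'rV['F_p]_e.+2) (w : 'rV['F_p]_(p ^ e)) :
  (row_mx a w <= dual_gen G')%MS = (a == - (w *m G^T)).
Proof.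
rewrite /dual_gen sub_kermx tr_row_mx mul_row_col trmx1 mulmx1.
by rewrite addr_eq0.
Qed.

Lemma trace_powers_eq0 (x : F) : (forall k : 'I_e, tr (beta ^+ k * x) = 0) -> x = 0.
Proof.
move=> x0; apply: (trace_nondegenerate charFp cardF) => b.
have [u <-] := powers_span charFp cardF beta_prim b.
rewrite mulr_suml (trace_sum charFp cardF) big1 // => k _.
by rewrite -mulrA (traceZ charFp cardF) x0 mulr0.
Qed.

(** Besides the entry 1 in row 0, a column has the entry f(0) + 1 = 1 if [d j = 0], and otherwise a
    nonzero trace. This handles dual words with one nonzero coordinate in the right half. *)
Lemma wt_col_G2 j (a : 'rV['F_p]_e.+2) (c : 'F_p) :
  c != 0 -> (forall i, a 0 i = c * G i j) -> (2 <= wt a)%N.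
Proof.
move=> c0 aE.
have a0 : a 0 i0 != 0 by rewrite aE G2_row0 mulr1.
have [dj|dj] := eqVneq (d j) 0.
  by apply: (@wt_ge2 _ _ _ i0 i1) => //; rewrite aE G2_row1 dj f0 add0r mulr1.
have /existsP[k kP] : [exists k : 'I_e, tr (beta ^+ k * d j) != 0].
  rewrite -negb_forall; apply: contra dj => /forallP H.
  by apply/eqP/trace_powers_eq0 => k; apply/eqP.
by apply: (@wt_ge2 _ _ _ i0 (it k)) => //; rewrite aE G2_rowt mulf_neq0.
Qed.

Lemma min_dist_dual : min_dist (dual_gen G') 3.
Proof.
split.
  have [d' dK d'K] := d_bij.
  (* The column at x = 0 is (1, 1, 0, ..., 0), so this choice costs exactly two further coordinates
     in the left half. *)
  pose w : 'rV['F_p]_(p ^ e) := delta_mx 0 (d' 0).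
  exists (row_mx (- (w *m G^T)) w).
  have wt3 : wt (row_mx (- (w *m G^T)) w) = 3%N.
    rewrite wt_row_mx /wt -!sum1dep_card addnC -[RHS]/(1 + 2)%N; congr (_ + _)%N.
      rewrite (bigD1 (d' 0)) ?mxE ?eqxx ?oner_neq0 // big1 // => j.
      by rewrite mxE eqxx /= => /andP[+ /negPf jd]; rewrite jd eqxx.
    have wE i : (- (w *m G^T)) 0 i = - G i (d' 0).
      by rewrite -rowE !mxE.
    rewrite big_mkcond !big_ord_recl big1 ?addn0 => [|k _].
      by rewrite !wE G2_row0 G2_row1 d'K f0 add0r oppr_eq0 oner_neq0.
    by rewrite wE (G2_rowt k) d'K mulr0 (trace0 charFp cardF) oppr0 eqxx.
  by rewrite dual_G2'P eqxx wt3; split=> //; split=> //; rewrite -wt_gt0 wt3.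
move=> v; rewrite -[v]hsubmxK; move: (lsubmx v) (rsubmx v) => a w.
rewrite dual_G2'P => /eqP aE vn0; rewrite wt_row_mx.
have wE i : a 0 i = - \sum_(j | w 0 j != 0) w 0 j * G i j.
  rewrite aE mxE [X in - X]mxE; congr (- _); rewrite [RHS]big_mkcond; apply: eq_bigr => j _.
  by rewrite mxE; case: eqP => [->|_] //=; rewrite mul0r.
pose S := [set j | w 0 j != 0].
have {}wE i : a 0 i = - \sum_(j in S) w 0 j * G i j.
  by rewrite wE; congr (- _); apply: eq_bigl => j; rewrite inE.
have -> : wt w = #|S| by [].
(* Split on the weight of the right half: 0 gives the zero word, 1 is settled by the columns having
   two nonzero entries, and 2 remains to be excluded when the left half vanishes. *)
case cS : #|S| => [|[|[|n]]]; last by rewrite !addnS.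
- have w0 : w = 0 by apply/eqP; rewrite -[_ == _]negbK -wt_gt0 -[wt w]/#|S| cS.
  by move: vn0; rewrite aE w0 mul0mx oppr0 row_mx0 eqxx.
- have /cards1P[j SE] : #|S| == 1%N by rewrite cS.
  have : j \in S by rewrite SE set11.
  rewrite inE -oppr_eq0 addn1 ltnS => wj; apply: (wt_col_G2 wj) => i.
  by rewrite wE SE big_set1 mulNr.
have /cards2P[j [k [jk SE]]] : #|S| == 2%N by rewrite cS.
rewrite addn2 !ltnS wt_gt0; apply/eqP => a0.
have wjk i : w 0 j * G i j + w 0 k * G i k = 0.
  have := wE i; rewrite a0 mxE SE big_setU1 ?inE // big_set1 => /esym/eqP.
  by rewrite oppr_eq0 => /eqP.
(* The all-ones row forces opposite coefficients; the trace rows then identify the two points,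
   against the injectivity of [d]. *)
have wk : w 0 k = - w 0 j.
  by apply/eqP; rewrite -addr_eq0 addrC; have := wjk i0; rewrite !G2_row0 !mulr1 => ->.
have wj : w 0 j != 0.
  by have := set21 j k; rewrite -SE inE.
case/negP: jk; rewrite -(inj_eq (bij_inj d_bij)) -subr_eq0; apply/eqP.
apply: trace_powers_eq0 => t; apply: (mulfI wj).
rewrite mulrBr (traceD charFp cardF) (traceN charFp cardF) mulr0.
by have := wjk (it t); rewrite !G2_rowt wk mulNr -mulrBr.
Qed.

Lemma rank_dual : \rank (dual_gen G') = (p ^ e)%N.
Proof. by rewrite /dual_gen mxrank_ker mxrank_tr rank_G2' addKn. Qed.

End BentCode.

(** * The sphere-packing bound at distance 5 *)

Lemma sphere_packing_dual (p e : nat) : (2 < p)%N -> (1 < e)%N ->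
  sphere_packing_rules_out p (p ^ e + e + 2) (p ^ e) (3 + 2).
Proof.
move=> p3 e2; rewrite /sphere_packing_rules_out -addnA expnD ltn_pmul2l; last first.
  by rewrite expn_gt0; lia.
(* The radius is 2, and p^(e+2) remains to be beaten; the quadratic term of the ball does so alone,
   by C(n,2) >= 8q and p^2 < 4(p-1)^2. *)
rewrite !big_ord_recr big_ord0 /= expn0 bin0 bin1 bin2 expn1 expnD.
have p2e : (p ^ 2 <= p ^ e)%N by rewrite leq_exp2l //; lia.
set q := (p ^ e)%N in p2e *.
have q9 : (9 <= q)%N by nia.
set n := (q + (e + 2))%N.
have n8 : (8 * q <= (n * n.-1)./2)%N.
  rewrite geq_half_double -muln2.
  have nq : (q + 4 <= n)%N by rewrite /n; lia.
  nia.
have p4 : (p ^ 2 < 4 * p.-1 ^ 2)%N by nia.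
have : (q * p ^ 2 < (n * n.-1)./2 * p.-1 ^ 2)%N.
  rewrite (@leq_trans (q * (4 * p.-1 ^ 2))) ?ltn_pmul2l //; first lia.
  rewrite mulnA leq_mul2r; apply/orP; right; lia.
rewrite /q; lia.
Qed.

(** * From the Walsh transform to the theorem *)

Lemma wrb_fiber (p e : nat) (F : finFieldType) (f : F -> 'F_p) (eps s : int) :
  prime p -> odd p -> (0 < e)%N -> ~~ odd e -> #|F| = (p ^ e)%N -> wrb_sign e f eps ->
  eps * eta0 (-1 : 'F_p) ^+ (e./2) = s ->
  exists fstar : F -> 'F_p, forall b v,
    #|[set x | f x - trace p e (b * x) == v]|%:Z =
    p%:Z ^+ e.-1 - s * p%:Z ^+ (e./2).-1 + (v == fstar b)%:R * (s * p%:Z ^+ e./2).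
Proof.
move=> p_pr p_odd e_gt0 e_ev cardF [_ [fstar fE]] sE; exists fstar => b v.
have eE : e = (e./2).*2 by rewrite even_halfK.
rewrite [in p%:Z ^+ e.-1]eE; apply: card_fiber_bent => //; first lia.
  by rewrite cardF -eE.
have := fE b; rewrite /walsh [X in sqrt_pstar p ^+ X]eE sqrt_pstarX // => ->.
by rewrite -sE rmorphM mulrA.
Qed.

(* By evenness of f every fibre over a nonzero value is even, whereas the fibre
   over [fstar 0] is odd. *)
Lemma even_wrb_dual0 (p e : nat) (F : finFieldType) (f : F -> 'F_p)
    (s : int) (j : 'F_p) :
  prime p -> odd p -> #|F| = (p ^ e)%N -> (s = 1 \/ s = -1) ->
  f 0 = 0 -> (forall x, f (- x) = f x) ->
  (forall v, #|[set x | f x == v]|%:Z =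
    p%:Z ^+ e.-1 - s * p%:Z ^+ (e./2).-1 + (v == j)%:R * (s * p%:Z ^+ e./2)) ->
  j = 0.
Proof.
move=> p_pr p_odd cardF sP f0 fN fE; apply: contraTeq isT => j0.
have charFp : p \in [pchar F] by exact: card_finPcharP cardF p_pr.
have F2 : (2%:R : F) != 0.
  rewrite -(dvdn_pcharf charFp) dvdn_prime2 //.
  by apply: contraTN p_odd => /eqP->.
have /negP[] : ~~ odd #|[set x | f x == j]|.
  apply: even_card_opp_closed => //; first by rewrite inE f0 eq_sym.
  by move=> x; rewrite !inE fN.
have XE n : p%:Z ^+ n = (p ^ n)%N%:Z by rewrite -[p%:Z]natz -natrX natz.
have := fE j; rewrite eqxx mul1r !XE.
(* The size of the fibre over [j] is a signed sum of three odd powers of p. *)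
have o n : odd (p ^ n) by rewrite oddX p_odd orbT.
have := o e.-1; have := o (e./2).-1; have := o (e./2).
clear -sP.
case: sP => ->; rewrite ?mulN1r ?mul1r; lia.
Qed.

Theorem theorem4p4 (p e : nat) (F : finFieldType) (f : F -> 'F_p) (eps : int)
  (beta : F) (d : 'I_(p ^ e) -> F) :
  prime p -> odd p -> (2 <= e)%N -> ~~ odd e -> #|F| = (p ^ e)%N ->
  in_RF e f -> wrb_sign e f eps ->
  (#|F|.-1).-primitive_root beta ->
  bijective d -> (forall j : 'I_(p ^ e), val j = (p ^ e).-1 -> d j = 0) ->
  (eps * eta0 (-1 : 'F_p) ^+ (e./2) = 1 ->
     code_params (G2' f beta d) (p ^ e + e + 2)%N (e + 2)%N
       (p ^ e - p ^ e.-1 - p.-1 * p ^ (e./2).-1 + 2)%N) /\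
  (eps * eta0 (-1 : 'F_p) ^+ (e./2) = -1 ->
     code_params (G2' f beta d) (p ^ e + e + 2)%N (e + 2)%N
       (p ^ e - p ^ e.-1 - p ^ (e./2).-1 + 1)%N) /\
  code_params (dual_gen (G2' f beta d)) (p ^ e + e + 2)%N (p ^ e)%N 3%N /\
  sphere_packing_rules_out p (p ^ e + e + 2) (p ^ e) (3 + 2).
Proof.
move=> p_pr p_odd e2 e_ev cardF [_ [f0 [h [_ h_ev _ fh]]]] wrb beta_prim d_bij _.
have e_gt0 : (0 < e)%N by apply: ltnW.
have charFp : p \in [pchar F] by exact: card_finPcharP cardF p_pr.
have p3 : (2 < p)%N by have := prime_gt1 p_pr; lia.
have lenE : (p ^ e + e + 2 = e.+2 + p ^ e)%N by rewrite -addnA addn2 addnC.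
have rkE : \rank (G2' f beta d) = (e + 2)%N by rewrite rank_G2' addn2.
(* Evenness of [f] is homogeneity at a = -1 with an even exponent. *)
have fN x : f (- x) = f x.
  have := fh (-1) x; rewrite oppr_eq0 oner_neq0 => /(_ isT).
  have -> : Fp_to F (-1 : 'F_p) = -1.
    apply/eqP; rewrite -addr_eq0; apply/eqP.
    have := Fp_to_is_zmod_morphism charFp 0 1.
    by rewrite sub0r /Fp_to /= mulr1n mulr0n sub0r => ->; rewrite addNr.
  by rewrite mulN1r -signr_odd (negPf h_ev) expr0 mul1r.
have dual0 s (fstar : F -> 'F_p) : s = 1 \/ s = -1 ->
    (forall b v, #|[set x | f x - trace p e (b * x) == v]|%:Z = p%:Z ^+ e.-1
      - s * p%:Z ^+ (e./2).-1 + (v == fstar b)%:R * (s * p%:Z ^+ e./2)) ->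
    fstar 0 = 0.
  move=> sP fibE; apply: (even_wrb_dual0 p_pr p_odd cardF sP f0 fN) => v.
  rewrite -fibE; congr Posz; apply: eq_card => x.
  by rewrite !inE mul0r (trace0 charFp cardF) subr0.
have fib := wrb_fiber p_pr p_odd e_gt0 e_ev cardF wrb.
split; last split; last split.
- move=> /fib[fstar fibE]; split=> //; split=> //.
  by apply: (min_dist_pos _ _ _ _ _ _ fibE) => //; apply: dual0 fibE; left.
- move=> /fib[fstar fibE]; split=> //; split=> //.
  by apply: (min_dist_neg _ _ _ _ _ _ fibE) => //; apply: dual0 fibE; right.
- by split=> //; split; [exact: rank_dual | exact: min_dist_dual].
exact: sphere_packing_dual.
Qed.
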